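(* Let $u\in\mathbb{C}$ and let $\Phi_n$ be the monic orthogonal polynomials on the unit circle with respect to the weight function $w(\theta)=e^{2|u|\sin(\theta+\arg(u))}$, $\theta\in[0,2\pi]$. Then, for $n\ge1$, $\Phi_n$ and the reversed polynomial $\Phi_n^*$ satisfy $$\begin{aligned} z^2\Phi_n''(z)&+[-iuz^2+(2-n)z-i\overline u]\Phi_n'(z)\\ &-[n(1-iuz)+|u|^2(1-|\alpha_n|^2)(1-|\alpha_{n-1}|^2)+i(nu\overline{\alpha}_n\alpha_{n-1}-\overline u\,\alpha_n\overline{\alpha}_{n-1})]\Phi_n(z)=iu\overline{\alpha}_n\Phi_n^*(z), \end{aligned}$$ and $$\begin{aligned} z^2(\Phi_n^* )''(z)&+[-iuz^2+(2-n)z-i\overline u](\Phi_n^* )'(z)\\ &+[iu(n-2)z-|u|^2(1-|\alpha_n|^2)(1-|\alpha_{n-1}|^2)+iu\overline{\alpha}_n\alpha_{n-1}(1-n)]\Phi_n^*(z)=[2iu\alpha_{n-1}z+i\overline u\,\alpha_n]\Phi_n(z). \end{aligned}$$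
   Context: The monic orthogonal polynomials $\Phi_n$ ($\deg\Phi_n=n$) are orthogonal for $\langle f,g\rangle=\int_0^{2\pi}f(e^{i\theta})\overline{g(e^{i\theta})}\,w(\theta)\,d\theta$. Reversed polynomial: $\Phi_n^*(z)=z^n\overline{\Phi_n(1/\overline z)}$. Verblunsky coefficients: $\alpha_{n-1}=-\overline{\Phi_n(0)}$ for $n\ge1$, and $\alpha_{-1}=-1$. Prime denotes $d/dz$. When $u=0$ the weight is $w\equiv1$. *)

(* Defs.v *)
From HB Require Import structures.
From mathcomp Require Import all_boot all_order all_algebra.
From mathcomp Require Import complex ring.
From mathcomp Require Import all_classical all_reals all_analysis.

Set Implicit Arguments.
Unset Strict Implicit.
Unset Printing Implicit Defensive.

Import Order.TTheory GRing.Theory Num.Theory.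
Import numFieldNormedType.Exports.

Local Open Scope classical_set_scope.
Local Open Scope ring_scope.

(* [`|u|] is a (real) element of [R[i]]; this is the same modulus as a real. *)
Definition modulus (R : realType) (u : R[i]) : R := complex.Re `|u|.

(* Principal argument, in ]-pi, pi].  At [u = 0] the value is [pi / 2]
   (since [x / 0 = 0]), which is immaterial in [weight]. *)
Definition arg (R : realType) (u : R[i]) : R :=
  let a := acos (complex.Re u / modulus u) in
  if 0 <= complex.Im u then a else - a.

Definition cis (R : realType) (t : R) : R[i] := (cos t +i* sin t)%C.

Definition weight (R : realType) (u : R[i]) (t : R) : R :=
  expR (2 * modulus u * sin (t + arg u)).

Definition cintegral (R : realType) (D : set R) (f : R -> R[i]) : R[i] :=
  ((\int[lebesgue_measure]_(t in D) complex.Re (f t))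
   +i* (\int[lebesgue_measure]_(t in D) complex.Im (f t)))%C.

Definition inner (R : realType) (w : R -> R) (f g : R[i] -> R[i]) : R[i] :=
  cintegral `[0, 2 * pi] (fun t => f (cis t) * (g (cis t))^* * (w t)%:C%C).

Definition monic_orthogonal (R : realType) (w : R -> R)
    (Phi : nat -> {poly R[i]}) : Prop :=
  (forall n, Phi n \is monic /\ size (Phi n) = n.+1) /\
  (forall m n, m != n -> inner w (horner (Phi m)) (horner (Phi n)) = 0).

(* z^n * conj (p (1 / conj z)) as a polynomial in z, see [horner_reversed]. *)
Definition reversed (R : realType) (n : nat) (p : {poly R[i]}) : {poly R[i]} :=
  \poly_(k < n.+1) (p`_(n - k))^*.

(* [verblunsky Phi n] is alpha_n, for n >= 0; alpha_{-1} = -1 is not encoded. *)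
Definition verblunsky (R : realType) (Phi : nat -> {poly R[i]}) (n : nat)
    : R[i] := - ((Phi n.+1).[0])^*.

Lemma horner_reversed (R : realType) (n : nat) (p : {poly R[i]}) (z : R[i]) :
  (size p <= n.+1)%N -> z != 0 ->
  (reversed n p).[z] = z ^+ n * (p.[1 / z^*])^*.
Proof.
move=> sp z0.
rewrite (horner_coef_wide _ sp) rmorph_sum mulr_sumr /=.
rewrite horner_poly (reindex_inj rev_ord_inj) /=.
apply: eq_bigr => k _; have kn : (k <= n)%N by rewrite -ltnS.
rewrite subSS subKn // rmorphM rmorphXn /= div1r fmorphV /= conjCK.
have -> : z ^+ n = z ^+ (n - k) * z ^+ k by rewrite -exprD subnK.
by rewrite exprVn mulrCA mulfK ?expf_neq0.
Qed.

Lemma argP (R : realType) (u : R[i]) : u = (modulus u)%:C%C * cis (arg u).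
Proof.
case: u => a b; rewrite /arg /cis /modulus normc_def /=.
set m := Num.sqrt _; set t := acos _.
have m2 : m ^+ 2 = a ^+ 2 + b ^+ 2 by rewrite sqr_sqrtr // addr_ge0 ?sqr_ge0.
have m0 : 0 <= m by exact: sqrtr_ge0.
have [mz|mN0] := eqVneq m 0.
  move: m2; rewrite mz expr0n /= => /esym/eqP.
  rewrite paddr_eq0 ?sqr_ge0 // !sqrf_eq0 => /andP[/eqP-> /eqP->].
  by rewrite mul0r.
have mp : 0 < m by rewrite lt_def mN0.
have am : -1 <= a / m <= 1.
  by rewrite -ler_norml normrM normfV (ger0_norm m0) ler_pdivrMr // mul1r
    -(ger0_norm m0) -ler_sqr ?nnegrE // !real_normK ?num_real // m2 lerDl sqr_ge0.
have ct : cos t = a / m by rewrite /t acosK.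
have st : sin t = `|b| / m.
  rewrite /t sin_acos //.
  have -> : 1 - (a / m) ^+ 2 = (`|b| / m) ^+ 2.
    rewrite !expr_div_n real_normK ?num_real // -[b ^+ 2](addKr (a ^+ 2)) -m2.
    by field.
  by rewrite sqrtr_sqr ger0_norm // divr_ge0.
have cs : cos (if 0 <= b then t else - t) = a / m
  by case: ifP; rewrite ?cosN.
have ss : sin (if 0 <= b then t else - t) = b / m.
  case: ifP => bp; first by rewrite st ger0_norm.
  by rewrite sinN st ler0_norm ?mulNr ?opprK // ltW // ltNge bp.
rewrite cs ss; apply/eqP; rewrite eq_complex /= !mul0r subr0 addr0.
by rewrite ![m * _]mulrC !divfK // !eqxx.
Qed.

Lemma weight0 (R : realType) (t : R) : weight 0 t = 1.
Proof. by rewrite /weight /modulus normr0 /= mulr0 mul0r expR0. Qed.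

(* Main.v *)
(** Since dw/dtheta = (u z + conj(u) / z) w with z = e^{i theta}, integrating
    the derivative of p(z) conj(q(z)) w over a period gives
      i <z p', q> - i <p, z q'> + u <z p, q> + conj(u) <p, z q> = 0.
    Applied to p = Phi_n, it shows that z Phi_n' - n Phi_n is a combination of
    Phi_{n-1} and Phi*_{n-1}; reversal gives the analogous formula for
    (Phi*_n)'.  Differentiating this first-order system and eliminating
    Phi_{n-1}, Phi*_{n-1} by the Szego recurrence yields both equations, up to
    multiples of Re(u conj(alpha_n) alpha_{n-1}).  This real part vanishes: take
    p = q = Phi_n in the displayed identity. *)

Require Import Defs.
From mathcomp Require Import all_boot all_order all_algebra.
From mathcomp Require Import complex ring.
From mathcomp Require Import all_classical all_reals all_analysis.

Set Implicit Arguments.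
Unset Strict Implicit.
Unset Printing Implicit Defensive.

Import Order.TTheory GRing.Theory Num.Theory.
Import numFieldNormedType.Exports.

Local Open Scope classical_set_scope.
Local Open Scope ring_scope.

(** * Calculus of complex-valued functions of a real variable *)

Section ComplexValued.
Context {R : realType}.
Implicit Types (f g : R -> R[i]).

(** Differentiation is taken separately on real and imaginary parts, to match [cintegral], which
    integrates them separately. *)
Definition cderiv f g := forall t : R,
  is_derive t 1 (fun s => complex.Re (f s)) (complex.Re (g t)) /\
  is_derive t 1 (fun s => complex.Im (f s)) (complex.Im (g t)).

Definition ccont f :=
  continuous (fun s => complex.Re (f s)) /\
  continuous (fun s => complex.Im (f s)).

Lemma ReD (x y : R[i]) : complex.Re (x + y) = complex.Re x + complex.Re y.
Proof. by case: x y => ? ? []. Qed.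

Lemma ImD (x y : R[i]) : complex.Im (x + y) = complex.Im x + complex.Im y.
Proof. by case: x y => ? ? []. Qed.

Lemma ReM (x y : R[i]) :
  complex.Re (x * y) = complex.Re x * complex.Re y - complex.Im x * complex.Im y.
Proof. by case: x y => ? ? []. Qed.

Lemma ImM (x y : R[i]) :
  complex.Im (x * y) = complex.Re x * complex.Im y + complex.Im x * complex.Re y.
Proof. by case: x y => ? ? []. Qed.

Lemma Reconj (x : R[i]) : complex.Re (x^*) = complex.Re x.
Proof. by case: x. Qed.

Lemma Imconj (x : R[i]) : complex.Im (x^*) = - complex.Im x.
Proof. by case: x. Qed.

Lemma cderiv_cont f g : cderiv f g -> ccont f.
Proof.
move=> h; split=> t; apply: differentiable_continuous; apply/derivable1_diffP;
  by have [[]] := h t; have [_ []] := h t.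
Qed.

Lemma cderiv_eq f g g' : cderiv f g -> g =1 g' -> cderiv f g'.
Proof. by move=> h e t; rewrite -e. Qed.

Lemma cderivD f f' g g' : cderiv f f' -> cderiv g g' ->
  cderiv (fun t => f t + g t) (fun t => f' t + g' t).
Proof.
move=> hf hg t; have [f1 f2] := hf t; have [g1 g2] := hg t; split.
  under eq_fun do rewrite ReD; rewrite ReD; exact: is_deriveD.
by under eq_fun do rewrite ImD; rewrite ImD; exact: is_deriveD.
Qed.

Lemma cderivM f f' g g' : cderiv f f' -> cderiv g g' ->
  cderiv (fun t => f t * g t) (fun t => f' t * g t + f t * g' t).
Proof.
move=> hf hg t; have [f1 f2] := hf t; have [g1 g2] := hg t; split.
  under eq_fun do rewrite ReM; apply: is_derive_eq.
  by rewrite ReD !ReM /GRing.scale /=; ring.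
under eq_fun do rewrite ImM; apply: is_derive_eq.
by rewrite ImD !ImM /GRing.scale /=; ring.
Qed.

Lemma cderiv_cst (c : R[i]) : cderiv (fun=> c) (fun=> 0).
Proof. by move=> t; split; exact: is_derive_cst. Qed.

Lemma cderiv_conj f f' : cderiv f f' ->
  cderiv (fun t => (f t)^*) (fun t => (f' t)^*).
Proof.
move=> hf t; have [f1 f2] := hf t; split.
  by under eq_fun do rewrite Reconj; rewrite Reconj.
by under eq_fun do rewrite Imconj; rewrite Imconj; exact: is_deriveN.
Qed.

Lemma cderiv_cis : cderiv (@cis R) (fun t => 'i * cis t).
Proof.
move=> t; rewrite -complexiE /cis /=; split; apply: is_derive_eq; simpl; ring.
Qed.

Lemma cderiv_horner (p : {poly R[i]}) :
  cderiv (fun t => p.[cis t]) (fun t => 'i * cis t * (p^`()).[cis t]).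
Proof.
elim/poly_ind: p => [|p c IH].
  have -> : (fun t => (0 : {poly R[i]}).[cis t]) = (fun=> 0 : R[i]).
    by apply/funext => t; rewrite horner0.
  apply: cderiv_eq (cderiv_cst 0) _ => t.
  by rewrite deriv0 horner0 mulr0.
have -> : (fun t => (p * 'X + c%:P).[cis t]) = (fun t => p.[cis t] * cis t + c).
  by apply/funext => t; rewrite hornerMXaddC.
apply: cderiv_eq (cderivD (cderivM IH cderiv_cis) (cderiv_cst c)) _ => t.
by rewrite derivMXaddC !(hornerD, hornerMX); ring.
Qed.

(** By [argP], u e^{it} has modulus |u| and argument t + arg u, so twice its real part is 2|u| cos(t
    + arg u), the derivative of the exponent of the weight. *)
Lemma cderiv_weight (u : R[i]) :
  cderiv (fun t => (weight u t)%:C%C)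
         (fun t => (u * cis t + u^* * (cis t)^*) * (weight u t)%:C%C).
Proof.
move=> t; rewrite -rmorphM /=.
have -> : u * cis t + (u * cis t)^* = (2 * modulus u * cos (t + arg u))%:C%C.
  rewrite {1 2}(argP u) cosD; apply/eqP; rewrite eq_complex.
  by rewrite ReD ImD Reconj Imconj !ReM !ImM /=; apply/andP; split; apply/eqP;
    ring.
rewrite ReM ImM /= !mulr0 mul0r subr0 addr0; split; last exact: is_derive_cst.
rewrite /weight.
rewrite [X in is_derive _ _ _ X]mulrC.
apply: (@is_derive1_comp _ expR (fun s => 2 * modulus u * sin (s + arg u))).
have hs : is_derive t 1 (sin \o (fun s : R => s + arg u))
    (cos (t + arg u) * (1 + 0)).
  by apply: is_derive1_comp.
rewrite addr0 mulr1 in hs.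
apply: is_derive_eq; rewrite /GRing.scale /=; ring.
Qed.

Local Notation D := (`[(0 : R), 2 * pi]%classic).

Lemma ccont_integrable (f : R -> R) : continuous f ->
  (@lebesgue_measure R).-integrable D (EFin \o f).
Proof.
move=> cf; apply: continuous_compact_integrable; first exact: segment_compact.
exact: continuous_subspaceT.
Qed.

Lemma cintegralD f g : ccont f -> ccont g ->
  cintegral D (fun t => f t + g t) = cintegral D f + cintegral D g.
Proof.
move=> [f1 f2] [g1 g2]; rewrite /cintegral; apply/eqP; rewrite eq_complex /=.
rewrite -!RintegralD //; try exact: ccont_integrable.
by apply/andP; split; apply/eqP; apply: eq_Rintegral => t _; rewrite ?ReD ?ImD.
Qed.

Lemma cintegralZ (c : R[i]) f : ccont f ->
  cintegral D (fun t => c * f t) = c * cintegral D f.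
Proof.
move=> [f1 f2]; rewrite /cintegral; apply/eqP; rewrite eq_complex ReM ImM.
rewrite [X in (X == _) && _]/= [X in _ && (X == _)]/=.
rewrite -!RintegralZl //; try exact: ccont_integrable.
rewrite -RintegralD // -?RintegralB //;
  try (apply: ccont_integrable => x; apply: cvgM;
       [exact: cvg_cst | by [exact: f1 | exact: f2]]).
by apply/andP; split; apply/eqP; apply: eq_Rintegral => t _; rewrite ?ReM ?ImM.
Qed.

Lemma cintegral_conj f : ccont f ->
  cintegral D (fun t => (f t)^*) = (cintegral D f)^*.
Proof.
move=> [f1 f2]; rewrite /cintegral; apply/eqP.
rewrite eq_complex Reconj Imconj /=.
rewrite -mulN1r -RintegralZl //; last exact: ccont_integrable.
apply/andP; split; apply/eqP; apply: eq_Rintegral => t _.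
  by rewrite Reconj.
by rewrite Imconj mulN1r.
Qed.

Lemma Rintegral_deriv (f g : R -> R) :
  (forall t : R, is_derive t 1 f (g t)) -> continuous g ->
  \int[lebesgue_measure]_(t in D) g t = f (2 * pi) - f 0.
Proof.
move=> fg cg; have cf : continuous f.
  move=> t; apply: differentiable_continuous; apply/derivable1_diffP.
  by have [] := fg t.
rewrite /Rintegral (@continuous_FTC2 _ _ f) //.
- by rewrite mulr_gt0 // pi_gt0.
- exact: continuous_subspaceT.
- split; first by move=> t _; have [] := fg t.
    by apply: cvg_at_right_filter; exact: cf.
  by apply: cvg_at_left_filter; exact: cf.
- by move=> t _; rewrite derive1E; have [_ ->] := fg t.
Qed.

Lemma cintegral_deriv f g : cderiv f g -> ccont g ->
  cintegral D g = f (2 * pi) - f 0.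
Proof.
move=> fg [g1 g2]; rewrite /cintegral.
have -> := Rintegral_deriv (fun t => proj1 (fg t)) g1.
have -> := Rintegral_deriv (fun t => proj2 (fg t)) g2.
by case: (f _) (f 0) => ? ? [].
Qed.

Lemma ccontD f g : ccont f -> ccont g -> ccont (fun t => f t + g t).
Proof.
move=> [f1 f2] [g1 g2]; split.
  under eq_fun do rewrite ReD; by move=> t; apply: cvgD; [exact: f1|exact: g1].
by under eq_fun do rewrite ImD; move=> t; apply: cvgD; [exact: f2|exact: g2].
Qed.

Lemma ccontZ (c : R[i]) f : ccont f -> ccont (fun t => c * f t).
Proof.
move=> [f1 f2]; split.
  under eq_fun do rewrite ReM; move=> t; apply: cvgB; apply: cvgM;
    by [exact: cvg_cst|exact: f1|exact: f2].
under eq_fun do rewrite ImM; move=> t; apply: cvgD; apply: cvgM;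
  by [exact: cvg_cst|exact: f1|exact: f2].
Qed.

Lemma cisMconj (t : R) : cis t * (cis t)^* = 1.
Proof.
apply/eqP; rewrite eq_complex ReM ImM Reconj Imconj /= mulrN opprK -!expr2.
by rewrite cos2Dsin2 mulrN mulrC addrC subrr !eqxx.
Qed.

(** * The weighted inner product on the unit circle *)

Section InnerProduct.
Variable u : R[i].

Definition igd (p q : {poly R[i]}) (t : R) : R[i] :=
  p.[cis t] * (q.[cis t])^* * (weight u t)%:C%C.

Definition ip (p q : {poly R[i]}) : R[i] :=
  inner (weight u) (horner p) (horner q).

Implicit Types p q r : {poly R[i]}.

Lemma ip_eq p q p' q' : igd p q =1 igd p' q' -> ip p q = ip p' q'.
Proof. by move=> /funext e; rewrite /ip /inner -!/(igd _ _) e. Qed.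

(** Every factor z or conj(z) produced by the product rule is absorbed into p or q, so that the
    derivative is again a combination of integrands of [ip]. *)
Lemma cderiv_igd p q : cderiv (igd p q) (fun t =>
  'i * igd ('X * p^`()) q t + (- 'i * igd p ('X * q^`()) t
   + (u * igd ('X * p) q t + u^* * igd p ('X * q) t))).
Proof.
apply: cderiv_eq (cderivM (cderivM (cderiv_horner p)
  (cderiv_conj (cderiv_horner q))) (cderiv_weight u)) _ => t.
rewrite /igd !hornerM !hornerX !rmorphM /= conjCi; ring.
Qed.

Lemma ccont_igd p q : ccont (igd p q).
Proof. exact: cderiv_cont (cderiv_igd p q). Qed.

Lemma ipDl p q r : ip (p + q) r = ip p r + ip q r.
Proof.
rewrite -(cintegralD (ccont_igd p r) (ccont_igd q r)).
by congr cintegral; apply/funext => t; rewrite /igd hornerD; ring.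
Qed.

Lemma ipZl c p q : ip (c *: p) q = c * ip p q.
Proof.
rewrite -(cintegralZ c (ccont_igd p q)).
by congr cintegral; apply/funext => t; rewrite /igd hornerZ; ring.
Qed.

Lemma ipC p q : ip p q = (ip q p)^*.
Proof.
rewrite -(cintegral_conj (ccont_igd q p)).
congr cintegral; apply/funext => t; rewrite /igd !rmorphM /= conjCK.
have -> : ((weight u t)%:C%C)^* = (weight u t)%:C%C by exact: conjc_real.
by ring.
Qed.

Lemma ip_XX p q : ip ('X * p) ('X * q) = ip p q.
Proof.
apply: ip_eq => t; rewrite /igd !hornerM !hornerX rmorphM.
by rewrite mulrACA cisMconj mul1r.
Qed.

(** On the circle 1 / conj(z) = z, so the reversed polynomial takes the value z^n conj(p(z)); the
    factors z^n cancel and the conjugations exchange p and q. *)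
Lemma ip_reversed n p q : (size p <= n.+1)%N -> (size q <= n.+1)%N ->
  ip (reversed n p) (reversed n q) = ip q p.
Proof.
move=> sp sq; apply: ip_eq => t; rewrite /igd.
have z0 : cis t != 0.
  by apply: contra_eq_neq (cisMconj t) => ->; rewrite mul0r eq_sym oner_eq0.
have zz : 1 / (cis t)^* = cis t.
  by rewrite div1r -[LHS]mul1r -(cisMconj t) mulfK // conjC_eq0.
rewrite !horner_reversed // zz rmorphM rmorphXn /= conjCK mulrACA -exprMn.
by rewrite cisMconj expr1n; ring.
Qed.

Lemma ip_parts p q :
  'i * ip ('X * p^`()) q - 'i * ip p ('X * q^`()) + u * ip ('X * p) q
    + u^* * ip p ('X * q) = 0.
Proof.
have c := ccont_igd; have d := cderiv_igd p q.
(* Both [cis] and the weight have period 2 pi, so the boundary term vanishes. *)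
have e : igd p q (2 * pi) - igd p q 0 = 0.
  suff -> : igd p q (2 * pi) = igd p q 0 by rewrite subrr.
  have e2 : 2 * pi = 0 + pi *+ 2 :> R by rewrite add0r mulr_natl.
  have c2 : cis (2 * pi) = cis 0 :> R[i] by rewrite /cis e2 sinD2pi cosD2pi.
  rewrite /igd c2 /weight [2 * pi + _]addrC [0 + arg u]addrC.
  by rewrite [2 * pi]mulr_natl sinD2pi addr0.
have cc : forall a p' q', ccont (fun t => a * igd p' q' t).
  by move=> a p' q'; exact: ccontZ.
have c2 := ccontD (cc u ('X * p) q) (cc u^* p ('X * q)).
have c3 := ccontD (cc (- 'i) p ('X * q^`())) c2.
have c4 := ccontD (cc 'i ('X * p^`()) q) c3.
rewrite -[RHS]e -(cintegral_deriv d c4) (cintegralD (cc _ _ _) c3).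
rewrite (cintegralD (cc _ _ _) c2) (cintegralD (cc _ _ _) (cc _ _ _)).
rewrite !(cintegralZ _ (c _ _)) -!/(inner _ _ _) -!/(ip _ _); ring.
Qed.

(** On [0, pi] one has t = acos(cos t), so t is determined by the real part of the root [cis t], and
    p has finitely many roots. *)
Lemma finite_zeros_cis p : p != 0 ->
  finite_set (`[0, pi] `&` [set t : R | p.[cis t] = 0]).
Proof.
move=> p0; have [s sE] := closed_field_poly_normal p.
apply: (@sub_finite_set _ _ (acos @` [set` [seq complex.Re z | z <- s]])).
  move=> t /= [t1 t2]; exists (cos t); last exact: cosK.
  apply/mapP; exists (cis t) => //; move/rootP: t2.
  by rewrite sE rootZ ?lead_coef_eq0 // root_prod_XsubC.
exact/finite_image/finite_seq.
Qed.

(* The zeros of [p (cis t)] on [0, pi], where [cis] is injective, are finitely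
   many; if [ip p p] vanished, their complement would be negligible too. *)
Lemma ip_eq0 p : ip p p = 0 -> p = 0.
Proof.
move=> h; apply/eqP/negPn/negP => p0.
pose g t := complex.Re (igd p p t).
have gE t : g t = complex.Re (`|p.[cis t]| ^+ 2) * weight u t.
  by rewrite /g /igd normCK ReM /= mulr0 subr0.
have g0 t : 0 <= g t.
  rewrite gE mulr_ge0 ?expR_ge0 //.
  have := exprn_ge0 2 (normr_ge0 p.[cis t]); by rewrite lecE => /andP[].
have cg : continuous g by have [] := ccont_igd p p.
have ig := ccont_integrable cg.
have i0 : (\int[lebesgue_measure]_(t in D) (g t)%:E = 0)%E.
  have gf : (\int[lebesgue_measure]_(t in D) (g t)%:E \is a fin_num)%E.
    exact: integrable_fin_num ig.
  by rewrite -(fineK gf); congr (_%:E); exact: (congr1 (@complex.Re R) h).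
have mg := measurable_int _ ig.
have ia : (\int[lebesgue_measure]_(t in D) `|(g t)%:E| = 0)%E.
  by rewrite -[RHS]i0; apply: eq_integral => t _; rewrite gee0_abs ?lee_fin.
have /(ae_eq_integral_abs (@lebesgue_measure R) _ mg) ae := ia.
have nZ : (@lebesgue_measure R).-negligible
    (`[0, pi] `&` [set t : R | p.[cis t] = 0]).
  have c := finite_set_countable (finite_zeros_cis p0).
  apply/negligibleP; last exact: countable_lebesgue_measure0.
  exact: countable_measurable.
have pi0 : 0 < pi :> R := pi_gt0 R.
have npi : (@lebesgue_measure R).-negligible `[0, pi].
  apply: negligibleS (negligibleU (ae (measurable_itv _)) nZ) => t /= tpi.
  have [pt0|/eqP pt0] := eqVneq p.[cis t] 0; [by right|left => gt0].
  have tD : t \in `[0, 2 * pi].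
    move: tpi; rewrite !in_itv /= => /andP[-> tpi].
    by rewrite (le_trans tpi) // mulr_natl mulr2n lerDl ltW.
  have /eqP := gt0 tD; rewrite eqe gE mulf_eq0.
  rewrite [weight u t == 0]gt_eqF ?expR_gt0 // orbF.
  rewrite normc_def -rmorphXn /= sqr_sqrtr ?addr_ge0 ?sqr_ge0 //.
  rewrite paddr_eq0 ?sqr_ge0 // !sqrf_eq0 => pt.
  by apply: pt0; apply/eqP; rewrite eq_complex.
have : (@lebesgue_measure R `[0%R, pi] = 0)%E.
  by apply/negligibleP => //; exact: measurable_itv.
rewrite lebesgue_measure_itv /= lte_fin pi0 oppr0 adde0 => -[] /eqP.
by rewrite gt_eqF.
Qed.
End InnerProduct.
End ComplexValued.

(** * Degree bounds for polynomials *)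

Section PolySize.
Context {K : idomainType}.
Implicit Types p q : {poly K}.

Lemma polyX_factor n q : (size q <= n.+1)%N -> q`_0 = 0 ->
  exists2 r, q = 'X * r & (size r <= n)%N.
Proof.
move=> sq q0; exists (\poly_(i < n) q`_i.+1); last exact: size_poly.
apply/polyP => -[|k]; rewrite coefXM //= coef_poly; case: ltnP => // nk.
by rewrite nth_default // (leq_trans sq).
Qed.

Lemma size_polyXM n q : (size q <= n)%N -> (size ('X * q)%R <= n.+1)%N.
Proof.
by move=> sq; rewrite (leq_trans (size_polyMleq _ _)) // size_polyX add2n.
Qed.

Lemma size_polyD_leq n p q :
  (size p <= n)%N -> (size q <= n)%N -> (size (p + q)%R <= n)%N.
Proof. by move=> sp sq; rewrite (leq_trans (size_polyD _ _)) // geq_max sp. Qed.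

Lemma size_polyZ_leq n c p : (size p <= n)%N -> (size (c *: p)%R <= n)%N.
Proof. by move=> sp; rewrite (leq_trans (size_scale_leq _ _)). Qed.

Lemma size_MX_deriv n q : (size q <= n)%N -> (size ('X * q^`())%R <= n)%N.
Proof.
move=> sq; apply/leq_sizeP => -[|j] nj; rewrite coefXM //= coef_deriv.
by rewrite nth_default ?mul0rn // (leq_trans sq).
Qed.

End PolySize.

(** * Algebra of reversed polynomials *)

Section Reversed.
Context {R : realType}.
Implicit Types p q : {poly R[i]}.

Lemma coef_reversed n p k :
  (reversed n p)`_k = if (k <= n)%N then (p`_(n - k))^* else 0.
Proof. by rewrite coef_poly ltnS. Qed.

Lemma size_reversed n p : (size (reversed n p) <= n.+1)%N.
Proof. exact: size_poly. Qed.

Lemma reversedK n p : (size p <= n.+1)%N -> reversed n (reversed n p) = p.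
Proof.
move=> sp; apply/polyP => k; rewrite !coef_reversed leq_subr.
case: leqP => kn; first by rewrite subKn // conjCK.
by rewrite nth_default // (leq_trans sp).
Qed.

Lemma reversedD n p q : reversed n (p + q) = reversed n p + reversed n q.
Proof.
apply/polyP => k; rewrite coefD !coef_reversed coefD rmorphD.
by case: leqP => //; rewrite addr0.
Qed.

Lemma reversedZ n c p : reversed n (c *: p) = c^* *: reversed n p.
Proof.
apply/polyP => k; rewrite coefZ !coef_reversed coefZ rmorphM.
by case: leqP => //; rewrite mulr0.
Qed.

Lemma reversedMX n p : reversed n.+1 ('X * p) = reversed n p.
Proof.
apply/polyP => k; rewrite !coef_reversed coefXM.
case: (ltngtP k n.+1) => [kn|kn|->]; last by rewrite subnn conjC0 ltnn.
  by rewrite -ltnS kn subSn.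
by rewrite leqNgt (ltnW kn).
Qed.

Lemma reversedS n p : (size p <= n.+1)%N -> reversed n.+1 p = 'X * reversed n p.
Proof.
move=> sp; apply/polyP => -[|k]; rewrite coefXM !coef_reversed //=.
by rewrite subn0 nth_default ?conjC0.
Qed.

(** The operator z d/dz multiplies z^k by k, and reversal exchanges k with n - k, so the two factors
    add up to n. *)
Lemma reversedMX_deriv n p :
  reversed n ('X * p^`()) + 'X * (reversed n p)^`() = n%:R *: reversed n p.
Proof.
apply/polyP => k; rewrite coefD coefZ coefXM !coef_reversed !coefXM !coef_deriv.
case: leqP => [kn|kn]; last first.
  case: k kn => // k kn /=; rewrite coef_reversed leqNgt kn /=.
  by rewrite mul0rn addr0 mulr0.
case: k kn => [|k] kn /=.
  rewrite subn0 addr0; case: n kn => [|n] _ /=; first by rewrite conjC0 mul0r.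
  by rewrite rmorphMn mulr_natl.
rewrite coef_reversed kn; case: (n - k.+1)%N (subnK kn) => [|m] <- /=.
  by rewrite conjC0 add0r add0n mulr_natl.
by rewrite rmorphMn -mulrnDr mulr_natl.
Qed.
End Reversed.

(** * Szego recurrence and the first-order differential system *)

Section Orthogonal.
Context {R : realType}.
Variables (u : R[i]) (Phi : nat -> {poly R[i]}).
Hypothesis hPhi : monic_orthogonal (weight u) Phi.
Implicit Types (p q r : {poly R[i]}) (n m : nat).
Local Notation "<< p , q >>" := (ip u p q).
Local Notation Phis n := (reversed n (Phi n)).
Local Notation alpha := (verblunsky Phi).
Local Notation h n := (ip u (Phi n) (Phi n)).

Lemma ipDr p q r : <<p, q + r>> = <<p, q>> + <<p, r>>.
Proof. by rewrite ipC ipDl rmorphD /= -!ipC. Qed.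

Lemma ipZr c p q : <<p, c *: q>> = c^* * <<p, q>>.
Proof. by rewrite ipC ipZl rmorphM /= -ipC. Qed.

Lemma ip0r p : <<p, 0>> = 0.
Proof. by rewrite -(scale0r 0) ipZr conjC0 mul0r. Qed.

Lemma ipNl p q : <<- p, q>> = - <<p, q>>.
Proof. by rewrite -scaleN1r ipZl mulN1r. Qed.

Lemma size_Phi n : size (Phi n) = n.+1. Proof. by case: hPhi => /(_ n)[]. Qed.

Lemma monic_Phi n : Phi n \is monic. Proof. by case: hPhi => /(_ n)[]. Qed.

Lemma coefn_Phi n : (Phi n)`_n = 1.
Proof. by have := monicP (monic_Phi n); rewrite /lead_coef size_Phi. Qed.

Lemma size_subZ_Phi n q : (size q <= n.+1)%N ->
  (size (q - q`_n *: Phi n)%R <= n)%N.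
Proof.
move=> sq; apply/leq_sizeP => j; rewrite leq_eqVlt => /predU1P[<-|nj].
  by rewrite coefB coefZ coefn_Phi mulr1 subrr.
rewrite coefB coefZ [q`_j]nth_default ?(leq_trans sq) //.
by rewrite [(Phi n)`_j]nth_default ?size_Phi // mulr0 subr0.
Qed.

Lemma ip_Phi_lt n q : (size q <= n)%N -> <<Phi n, q>> = 0.
Proof.
(* Induction on a degree bound m: subtracting a multiple of Phi_m lowers the bound, and each Phi_m
   subtracted has m < n. *)
move: q; suff H m : (m <= n)%N -> forall r, (size r <= m)%N -> <<Phi n, r>> = 0.
  by move=> q; exact: H.
elim: m => [|m IH] mn q sq.
  by move: sq; rewrite leqn0 size_poly_eq0 => /eqP ->; rewrite ip0r.
rewrite -[q](subrK (q`_m *: Phi m)) ipDr ipZr (IH (ltnW mn)) ?size_subZ_Phi //.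
have -> : <<Phi n, Phi m>> = 0 by case: hPhi => _; apply; rewrite gtn_eqF.
by rewrite mulr0 addr0.
Qed.

Lemma ip_Phi n q : (size q <= n.+1)%N -> <<Phi n, q>> = (q`_n)^* * h n.
Proof.
move=> sq; rewrite -{1}[q](subrK (q`_n *: Phi n)) ipDr ipZr.
by rewrite ip_Phi_lt ?add0r // size_subZ_Phi.
Qed.

(** Reversal swaps the arguments of the inner product and moves the constant coefficient to the top,
    which reduces this to [ip_Phi]. In particular Phi*_n is orthogonal to z, ..., z^n. *)
Lemma ip_Phis n q : (size q <= n.+1)%N -> <<Phis n, q>> = (q`_0)^* * h n.
Proof.
move=> sq; rewrite -{1}(reversedK sq) ip_reversed ?size_reversed ?size_Phi //.
rewrite ipC ip_Phi ?size_reversed // coef_reversed leqnn subnn conjCK.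
by rewrite rmorphM /= -ipC.
Qed.

Lemma h_neq0 n : h n != 0.
Proof. by apply/eqP => /ip_eq0 /eqP; rewrite -size_poly_eq0 size_Phi. Qed.

Lemma coef0_Phis n : (Phis n)`_0 = 1.
Proof. by rewrite coef_reversed subn0 coefn_Phi conjC1. Qed.

Lemma alphaE n : alpha n = - ((Phi n.+1)`_0)^*.
Proof. by rewrite /verblunsky horner_coef0. Qed.

Lemma size_coef0 n q : (size q <= n.+1)%N -> q`_n = 0 -> (size q <= n)%N.
Proof. by move=> sq q0; have := size_subZ_Phi sq; rewrite q0 scale0r subr0. Qed.

(* The difference of the two sides is ['X * r] with [size r <= n], and all three
   terms are orthogonal to it. *)
Lemma szego n : 'X * Phi n = Phi n.+1 + (alpha n)^* *: Phis n.
Proof.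
apply/eqP; rewrite -subr_eq0; apply/eqP; set d := _ - _.
have sd : (size d <= n.+1)%N.
  apply: size_coef0.
    rewrite /d opprD -scaleN1r -scaleNr.
    rewrite !size_polyD_leq ?size_polyZ_leq ?size_polyXM ?size_Phi //.
    by rewrite (leq_trans (size_reversed _ _)).
  by rewrite coefB coefD coefXM coefZ /= !coefn_Phi coef_reversed ltnn mulr0; ring.
have d0 : d`_0 = 0.
  by rewrite coefB coefD coefXM coefZ coef0_Phis alphaE rmorphN /= conjCK; ring.
have [r dE sr] := polyX_factor sd d0.
apply: (@ip_eq0 _ u); rewrite {2}dE /d opprD !ipDl !ipNl ipZl ip_XX.
rewrite ip_Phi_lt // ip_Phi_lt ?size_polyXM // ip_Phis ?size_polyXM //.
by rewrite coefXM conjC0 mul0r; ring.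
Qed.

(** This is [szego] reversed at degree n + 1, where the factor z on its left side disappears. *)
Lemma szego_reversed n : Phis n = Phis n.+1 + alpha n *: ('X * Phi n).
Proof.
have := congr1 (reversed n.+1) (szego n); rewrite reversedMX reversedD reversedZ.
by rewrite conjCK (reversedS (size_reversed _ _)) reversedK ?size_Phi.
Qed.

(** Pythagoras applied to [szego]: multiplication by z preserves norms, Phi*_n has the norm of
    Phi_n, and Phi_{n+1} is orthogonal to Phi*_n. *)
Lemma h_succ n : h n.+1 = (1 - `|alpha n| ^+ 2) * h n.
Proof.
have := ip_XX u (Phi n) (Phi n).
rewrite szego !(ipDl, ipDr, ipZl, ipZr) conjCK ip_reversed ?size_Phi // => hh.
have e0 : <<Phi n.+1, Phis n>> = 0 by rewrite ip_Phi_lt ?size_reversed.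
have e1 : <<Phis n, Phi n.+1>> = 0 by rewrite ipC e0 conjC0.
by rewrite mulrBl mul1r -{1}hh e0 e1 normCK; ring.
Qed.

Lemma ip_MX n q : (size q <= n.+1)%N ->
  <<'X * Phi n, q>> = <<Phi n.+1, q>> + (alpha n)^* * ((q`_0)^* * h n).
Proof. by move=> sq; rewrite szego ipDl ipZl ip_Phis. Qed.

(** The difference d of the two sides has degree at most m, and <d, d> = 0 follows from [ip_parts]
    with q = d: it expresses <z Phi_{m+1}', d> through the top and constant coefficients of d, which
    are what Phi_m and Phi*_m detect. The factor 1 - |b|^2 converts h_{m+1} into h_m. *)
Lemma deriv_Phi m (b := alpha m) (a := alpha m.+1) :
  'X * (Phi m.+1)^`() = m.+1%:R *: Phi m.+1
    + (1 - `|b| ^+ 2) *: (('i * u^*) *: Phi m + ('i * u * a^*) *: Phis m).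
Proof.
apply/eqP; rewrite -subr_eq0; apply/eqP; set d := _ - _.
have sd : (size d <= m.+1)%N.
  apply: size_coef0.
    rewrite /d opprD -!scaleNr !size_polyD_leq ?size_polyZ_leq ?size_polyD_leq
      ?size_MX_deriv ?size_polyZ_leq ?size_Phi //.
    by rewrite (leq_trans (size_reversed _ _)).
  rewrite coefB !(coefD, coefZ) coefXM /= coef_deriv !coefn_Phi coef_reversed.
  rewrite ltnn (nth_default _ (eq_leq (size_Phi m))) !mulr0 !addr0 mulr0 mulr1.
  by rewrite addr0 subrr.
apply: (@ip_eq0 _ u).
have parts := ip_parts u (Phi m.+1) d.
(* Orthogonality kills <Phi_{m+1}, z d'> and, on the next line, <Phi_{m+2}, d>. *)
rewrite (ip_Phi_lt (size_MX_deriv sd)) ip_MX ?(leqW sd) // in parts.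
rewrite (ip_Phi_lt (leqW sd)) (ip_Phi (size_polyXM sd)) coefXM h_succ /= in parts.
rewrite {1}/d opprD !(ipDl, ipNl, ipZl) (ip_Phi_lt sd) (ip_Phi sd) (ip_Phis sd).
have -> : <<'X * (Phi m.+1)^`(), d>> = - 'i * ('i * <<'X * (Phi m.+1)^`(), d>>).
  by rewrite mulrA mulNr -expr2 sqrCi opprK mul1r.
move: parts; rewrite mulr0 subr0 => /eqP; rewrite -addrA addr_eq0 => /eqP ->.
by rewrite /a /b; ring.
Qed.

Lemma re_alpha_eq0 m :
  u * (alpha m.+1)^* * alpha m + u^* * alpha m.+1 * (alpha m)^* = 0.
Proof.
have sP : (size (Phi m.+1) <= m.+2)%N by rewrite size_Phi.
have hC : (h m.+1)^* = h m.+1 by rewrite -ipC.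
have parts := ip_parts u (Phi m.+1) (Phi m.+1).
have e1 : <<Phi m.+1, 'X * (Phi m.+1)^`()>> = m.+1%:R * h m.+1.
  by rewrite (ip_Phi (size_MX_deriv sP)) coefXM coef_deriv coefn_Phi conjC_nat.
(* Only the Phi*_{m+1} term of the recurrence contributes; it picks out Phi_{m+1}(0), which is -
   conj(alpha_m). *)
have e2 : <<'X * Phi m.+1, Phi m.+1>> = - ((alpha m.+1)^* * alpha m * h m.+1).
  by rewrite ip_MX // ip_Phi_lt ?size_Phi // (alphaE m); ring.
move: (alpha m.+1) (alpha m) e2 => a b e2.
rewrite (ipC _ _ (Phi m.+1)) (ipC _ _ ('X * Phi m.+1)) e1 e2 in parts.
(* The two derivative terms are conjugate to each other up to sign and equal to (m+1) h_{m+1}, a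
   real number, up to the factor i; hence they cancel. *)
rewrite rmorphN !rmorphM /= !conjCK conjC_nat hC subrr add0r in parts.
apply: (mulIf (h_neq0 m.+1)); rewrite mul0r -[RHS]oppr0 -[in RHS]parts; ring.
Qed.

(** Reversing [deriv_Phi] at degree m + 1 and inserting it in [reversedMX_deriv] cancels the
    multiples of Phi*_{m+1}. Phi_m and Phi*_m exchange roles, each with a factor z that is then
    divided out. *)
Lemma deriv_Phis m (b := alpha m) (a := alpha m.+1) :
  (Phis m.+1)^`() =
    (1 - `|b| ^+ 2) *: (('i * u^* * a) *: Phi m + ('i * u) *: Phis m).
Proof.
have := reversedMX_deriv m.+1 (Phi m.+1).
rewrite deriv_Phi -/b -/a; move: b a => b a.
rewrite !(reversedD, reversedZ) (reversedS (size_reversed _ _)).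
rewrite (reversedS (eq_leq (size_Phi m))) (reversedK (eq_leq (size_Phi m))).
rewrite conjC_nat -addrA => /(canRL (addKr _)); rewrite addNr.
rewrite normCK rmorphB !rmorphM /= !conjCK conjC1 conjCi => /eqP.
rewrite addr_eq0 => /eqP e.
apply: (mulfI (negbT (polyX_eq0 _))); rewrite -[LHS]opprK -e.
rewrite -!scalerAr -!mul_polyC !(polyCM, polyCN); ring.
Qed.

End Orthogonal.

(** * Elimination and the second-order equations *)

(* Read [c = 'i * u], [d = 'i * u^*], [a = alpha_n], [b = alpha_(n-1)], with
   primes for conjugates; [w] and [v] are the values of
   [(1 - `|b|^2) Phi_(n-1)] and [(1 - `|b|^2) Phi*_(n-1)], [p] and [q] those of
   [Phi_n] and [Phi*_n], and the digits count derivatives. *)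
Lemma ode_combination (K : comPzRingType)
    (c d a a' b b' n z p p1 p2 q q1 q2 w w1 v v1 : K) :
  c * a' * b + d * a * b' = 0 ->
  z * p1 = n * p + d * w + c * a' * v ->
  p1 + z * p2 = n * p1 + d * w1 + c * a' * v1 ->
  q1 = d * a * w + c * v -> q2 = d * a * w1 + c * v1 ->
  z * w = p + b' * q -> v = q + b * p ->
  w + z * w1 = p1 + b' * q1 -> v1 = q1 + b * p1 ->
  z ^+ 2 * p2 + (- c * z ^+ 2 + (2 - n) * z - d) * p1
    - (n * (1 - c * z) - c * d * (1 - a * a') * (1 - b * b')
       + (n * c * a' * b - d * a * b')) * p = c * a' * q
  /\ z ^+ 2 * q2 + (- c * z ^+ 2 + (2 - n) * z - d) * q1
    + (c * (n - 2) * z + c * d * (1 - a * a') * (1 - b * b')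
       + c * a' * b * (1 - n)) * q = (2 * c * b * z + d * a) * p.
Proof.
move=> s0 E1 E2 F1 -> S1 VE T1 V1E; split.
  apply/eqP; rewrite -subr_eq0; apply/eqP.
  (* The multipliers are found by elimination: the first term supplies z^2 p2, the second cancels
     w1, the third and fourth cancel w, and the remainder is a multiple of [s0]. *)
  transitivity (z * (p1 + z * p2 - (n * p1 + d * w1 + c * a' * v1))
    + d * (w + z * w1 - (p1 + b' * q1))
    + (1 - d * a * b' - c * z) * (z * p1 - (n * p + d * w + c * a' * v))
    + c * d * (a * a' - 1) * (z * w - (p + b' * q))
    + (c * a' * b + d * a * b') * (z * p1 + (1 - n) * p)).
    by rewrite V1E F1 VE; ring.
  by rewrite E1 E2 S1 T1 s0; ring.
apply/eqP; rewrite -subr_eq0; apply/eqP.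
(* Similarly, the first term accounts for w1, the second for p1, the third for w, and the last is a
   multiple of [s0]. *)
transitivity (d * a * z * (w + z * w1 - (p1 + b' * q1))
  + (c * z * b + d * a) * (z * p1 - (n * p + d * w + c * a' * v))
  + (c * b * d - d * a + (2 - n + d * a * b') * d * a) * (z * w - (p + b' * q))
  + (c * a' * b + d * a * b') * ((c * z * b + d * a) * p
     + (c * z + 1 - n + d * a * b') * q)).
  by rewrite V1E F1 VE; ring.
by rewrite E1 S1 T1 s0; ring.
Qed.

Theorem corollary4p24 (R : realType) (u : R[i]) (Phi : nat -> {poly R[i]})
    (hPhi : monic_orthogonal (weight u) Phi) (n : nat) (hn : (1 <= n)%N) :
  let P := Phi n in
  let Ps := reversed n (Phi n) in
  let a := verblunsky Phi n in
  let b := verblunsky Phi n.-1 in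
  (forall z : R[i],
     z ^+ 2 * (P^`()^`()).[z]
     + (- 'i * u * z ^+ 2 + (2 - n%:R) * z - 'i * u^*) * (P^`()).[z]
     - (n%:R * (1 - 'i * u * z)
        + `|u| ^+ 2 * (1 - `|a| ^+ 2) * (1 - `|b| ^+ 2)
        + 'i * (n%:R * u * a^* * b - u^* * a * b^*)) * P.[z]
     = 'i * u * a^* * Ps.[z])
  /\
  (forall z : R[i],
     z ^+ 2 * (Ps^`()^`()).[z]
     + (- 'i * u * z ^+ 2 + (2 - n%:R) * z - 'i * u^*) * (Ps^`()).[z]
     + ('i * u * (n%:R - 2) * z
        - `|u| ^+ 2 * (1 - `|a| ^+ 2) * (1 - `|b| ^+ 2)
        + 'i * u * a^* * b * (1 - n%:R)) * Ps.[z]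
     = (2 * 'i * u * b * z + 'i * u^* * a) * P.[z]).
Proof.
(* With n = m + 1 the index n - 1 is the natural number m, so alpha_{-1} never occurs. *)
case: n hn => // m _ /=.
set a := verblunsky Phi m.+1; set b := verblunsky Phi m.
set P := Phi m.+1; set Q := reversed m.+1 P.
set rho := 1 - `|b| ^+ 2.
(* Carrying the factor [rho] makes the inverse Szego relations [S1] and [S2] free of
   denominators. *)
pose T : {poly R[i]} := rho *: Phi m.
pose V : {poly R[i]} := rho *: reversed m (Phi m).
have sz := szego hPhi m; have sr := szego_reversed hPhi m.
rewrite -/P -/Q -/b in sz sr.
have rhoE : rho = 1 - b * b^* by rewrite /rho normCK.
(* Inserting [szego] in [szego_reversed] removes z Phi_m. *)
have QE : Q = reversed m (Phi m) - b *: (P + b^* *: reversed m (Phi m)).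
  by rewrite -sz {1}sr addrK.
have S1 : 'X * T = P + b^* *: Q.
  rewrite /T -scalerAr sz QE rhoE -!mul_polyC !(polyCM, polyCB, polyC1); ring.
have S2 : V = Q + b *: P.
  rewrite /V QE rhoE -!mul_polyC !(polyCM, polyCB, polyC1); ring.
have E : 'X * P^`() = m.+1%:R *: P + ('i * u^*) *: T + ('i * u * a^*) *: V.
  by rewrite (deriv_Phi hPhi) /T /V scalerDr !scalerA ![_ * rho]mulrC addrA.
have F : Q^`() = ('i * u^* * a) *: T + ('i * u) *: V.
  by rewrite (deriv_Phis hPhi) /T /V scalerDr !scalerA ![_ * rho]mulrC.
(* This is the product - c d of [ode_combination]. *)
have u2 : `|u| ^+ 2 = - ('i * u * ('i * u^*)).
  by rewrite normCK mulrACA -expr2 sqrCi mulN1r opprK.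
have s0 : 'i * u * a^* * b + 'i * u^* * a * b^* = 0.
  by rewrite -!mulrA -mulrDr !mulrA re_alpha_eq0 ?mulr0.
apply: all_and2 => z; rewrite rhoE u2 normCK.
clear sz sr QE rhoE; clearbody T V Q P.
have comb := @ode_combination _ ('i * u) ('i * u^*) a a^* b b^* m.+1%:R z
  P.[z] P^`().[z] P^`()^`().[z] Q.[z] Q^`().[z] Q^`()^`().[z]
  T.[z] T^`().[z] V.[z] V^`().[z].
have hE := (derivM, derivD, derivZ, derivX,
            hornerM, hornerX, hornerD, hornerZ, hornerC, mul1r).
case: (comb s0) => [||||||||c1 c2].
(* The premises are [E], [F], [S1], [S2] and their derivatives, evaluated at z. *)
- by have /(congr1 (horner^~ z)) := E; rewrite !hE.
- by have /(congr1 (fun p => p^`().[z])) := E; rewrite !hE.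
- by have /(congr1 (horner^~ z)) := F; rewrite !hE.
- by have /(congr1 (fun p => p^`().[z])) := F; rewrite !hE.
- by have /(congr1 (horner^~ z)) := S1; rewrite !hE.
- by have /(congr1 (horner^~ z)) := S2; rewrite !hE.
- by have /(congr1 (fun p => p^`().[z])) := S1; rewrite !hE.
- by have /(congr1 (fun p => p^`().[z])) := S2; rewrite !hE.
split; first by rewrite -c1; ring.
by rewrite -[2 * 'i * u]mulrA -c2; ring.
Qed.
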